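(* Let $r\ge1$ and let $G=\overline{\langle a_1,\dots,a_r\rangle}\subset W$ be the closed subgroup topologically generated by the elements $a_1,\dots,a_r\in W$ determined by $a_1=(a_r,1)\,\sigma$ and $a_i=(a_{i-1},1)$ for $2\le i\le r$. Let $N:=\operatorname{Norm}_W(G)$ and let $G_{\mathrm{ab}}$ be the maximal profinite abelian factor group of $G$. Then: (a) All odometers in $G$ are conjugate under $N$. (b) Any two odometers in $G$ with the same image in $G_{\mathrm{ab}}$ are conjugate under $G$.
   Context: $T$ is the infinite rooted binary tree whose vertices are the finite words over $\{0,1\}$, with root the empty word, each word $t$ being joined by an edge to $t0$ and $t1$. $W:=\operatorname{Aut}(T)$ is its automorphism group, a profinite group as the inverse limit of the finite groups $W_n=\operatorname{Aut}(T_n)$, where $T_n\subset T$ is the subtree of words of length $\le n$. For $u,v\in W$, $(u,v)\in W$ denotes the automorphism $0t\mapsto 0\,u(t)$, $1t\mapsto 1\,v(t)$ for all words $t$; $\sigma\in W$ is the automorphism of order $2$ with $0t\mapsto 1t$ and $1t\mapsto 0t$. Thus $W=(W\times W)\rtimes\langle\sigma\rangle$. The recursion relations for $a_1,\dots,a_r$ have a unique solution in $W$. $\operatorname{Norm}_W(G)$ is the normalizer of $G$ in $W$. The standard odometer is the unique element $a\in W$ with $a=(a,1)\,\sigma$; an odometer is any element of $W$ that is conjugate to $a$ under $W$. *)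

(* Defs.v *)
From HB Require Import structures.
From mathcomp Require Import all_boot.
From mathcomp Require Import all_classical topology.

Set Implicit Arguments.
Unset Strict Implicit.
Unset Printing Implicit Defensive.

Local Open Scope classical_set_scope.
Local Open Scope group_scope.

(* Vertices of the tree: [false] is the letter 0, [true] is the letter 1, and
   [b :: t] is the word with first letter [b].  Children are obtained by adding
   a letter at the end, whereas [pairW] and [sigmaW] act on the first letter. *)
Definition word := seq bool.

Definition joined (s t : word) : Prop :=
  exists b, t = rcons s b \/ s = rcons t b.

Record W := MkW {
  Wfun :> word -> word;
  Wfun_bij : bijective Wfun;
  Wfun_root : Wfun [::] = [::];
  Wfun_edge : forall s t, joined (Wfun s) (Wfun t) <-> joined s t
}.

Lemma W_ext (x y : W) : (forall t, x t = y t) -> x = y.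
Proof.
case: x y => [f b r e] [f' b' r' e'] /= /funext ff'; subst f'.
by congr MkW; apply: Prop_irrelevance.
Qed.

HB.instance Definition _ := gen_eqMixin W.
HB.instance Definition _ := gen_choiceMixin W.

Lemma Wone_edge s t : joined (id s) (id t) <-> joined s t.
Proof. by []. Qed.

Definition Wone : W := MkW (inv_bij (fun=> erefl)) erefl Wone_edge.

Lemma Wmul_edge (x y : W) s t : joined (x (y s)) (x (y t)) <-> joined s t.
Proof. by rewrite (Wfun_edge x) (Wfun_edge y). Qed.

Lemma Wmul_root (x y : W) : x (y [::]) = [::].
Proof. by rewrite !Wfun_root. Qed.

Definition Wmul (x y : W) : W :=
  @MkW (x \o y) (bij_comp (Wfun_bij x) (Wfun_bij y)) (Wmul_root x y)
    (Wmul_edge x y).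

Lemma Winv_ex (x : W) : exists y : W, cancel x y /\ cancel y x.
Proof.
have [g xK gK] := Wfun_bij x.
have gr : g [::] = [::] by rewrite -{1}(Wfun_root x) xK.
have ge s t : joined (g s) (g t) <-> joined s t.
  by rewrite -(Wfun_edge x) !gK.
by exists (MkW (Bijective gK xK) gr ge).
Qed.

Definition Winv (x : W) : W := projT1 (cid (Winv_ex x)).

Lemma WinvK (x : W) : cancel x (Winv x) /\ cancel (Winv x) x.
Proof. exact: (projT2 (cid (Winv_ex x))). Qed.

Lemma WmulA : associative Wmul. Proof. by move=> x y z; apply: W_ext. Qed.
Lemma Wmul1 : left_id Wone Wmul. Proof. by move=> x; apply: W_ext. Qed.
Lemma Wmulone : right_id Wone Wmul. Proof. by move=> x; apply: W_ext. Qed.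
Lemma WmulV : left_inverse Wone Winv Wmul.
Proof. by move=> x; apply: W_ext => t /=; case: (WinvK x). Qed.
Lemma WmulrV : right_inverse Wone Winv Wmul.
Proof. by move=> x; apply: W_ext => t /=; case: (WinvK x). Qed.

HB.instance Definition _ :=
  isGroup.Build W WmulA Wmul1 Wmulone WmulV WmulrV.

(* The profinite (inverse limit) topology: the neighbourhoods of [x] are the supersets of the
   fibres through [x] of the restriction maps to the words of length [<= n]. *)
Definition agree (n : nat) (x y : W) : Prop :=
  forall t : word, size t <= n -> x t = y t.

Definition Wnbhs (x : W) : set_system W :=
  [set A | exists n, agree n x `<=` A].

HB.instance Definition _ := hasNbhs.Build W Wnbhs.

Lemma Wnbhs_filter (x : W) : ProperFilter (Wnbhs x).
Proof.
split; first by case=> n /(_ x); apply.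
split; first by exists 0.
- move=> A B [n An] [m Bm]; exists (maxn n m) => y xy; split.
    by apply: An => t tn; apply: xy; rewrite leq_max tn.
  by apply: Bm => t tm; apply: xy; rewrite leq_max tm orbT.
- by move=> A B AB [n An]; exists n; apply: subset_trans AB.
Qed.

Lemma Wnbhs_singleton (x : W) (A : set W) : Wnbhs x A -> A x.
Proof. by case=> n; apply. Qed.

Lemma Wnbhs_nbhs (x : W) (A : set W) : Wnbhs x A -> Wnbhs x (Wnbhs^~ A).
Proof.
case=> n An; exists n => y xy; exists n => z yz; apply: An => t tn.
by rewrite xy // yz.
Qed.

HB.instance Definition _ := Nbhs_isNbhsTopological.Build W
  Wnbhs_filter Wnbhs_singleton Wnbhs_nbhs.

Definition pair_fun (u v : word -> word) (w : word) : word :=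
  if w is b :: t then b :: (if b then v t else u t) else [::].

Definition sigma_fun (w : word) : word :=
  if w is b :: t then ~~ b :: t else [::].

Lemma joined_sym s t : joined s t <-> joined t s.
Proof. by split=> -[b [->|->]]; exists b; [right|left|right|left]. Qed.

Lemma joined_nil t : joined [::] t <-> size t = 1%N.
Proof.
split=> [[b [->|/(congr1 size)]]|]; rewrite ?size_rcons //.
by case: t => [|b []] // _; exists b; left.
Qed.

Lemma joined_cons b c s t :
  joined (b :: s) (c :: t) <-> b = c /\ joined s t.
Proof.
split=> [[d [[-> ->]|[-> ->]]]|[-> [d [->|->]]]].
- by split=> //; exists d; left.
- by split=> //; exists d; right.
- by exists d; left.
- by exists d; right.
Qed.

Lemma Wsize0 (u : W) t : u t = [::] <-> t = [::].
Proof.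
split=> [ut|->]; last exact: Wfun_root.
by apply: (bij_inj (Wfun_bij u)); rewrite ut Wfun_root.
Qed.

Lemma pair_bij (u v : W) : bijective (pair_fun u v).
Proof.
have [uK u'K] := WinvK u; have [vK v'K] := WinvK v.
by exists (pair_fun (Winv u) (Winv v)) => -[|[] t] //=;
  rewrite ?uK ?vK ?u'K ?v'K.
Qed.

Lemma pair_edge (u v : W) s t :
  joined (pair_fun u v s) (pair_fun u v t) <-> joined s t.
Proof.
have nilE w : joined [::] (pair_fun u v w) <-> joined [::] w.
  rewrite !joined_nil; case: w => [|b w] //=.
  have -> : (if b then v w else u w) = (if b then v else u) w by case: b.
  have := Wsize0 (if b then v else u) w.
  by case: w (_ w) => [|c w] [|d w'] //= [p q]; split=> //;
    [move: (q erefl)|move: (p erefl)].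
case: s t => [|b s] [|c t].
- by split.
- exact: (nilE (c :: t)).
- by rewrite joined_sym (joined_sym (b :: s)); exact: (nilE (b :: s)).
- rewrite /= !joined_cons; split=> -[<-]; case: b;
  by rewrite (Wfun_edge _) => ?; split.
Qed.

Definition pairW (u v : W) : W :=
  @MkW (pair_fun u v) (pair_bij u v) erefl (pair_edge u v).

Lemma sigma_bij : bijective sigma_fun.
Proof. by exists sigma_fun => -[|b t] //=; rewrite negbK. Qed.

Lemma sigma_edge s t : joined (sigma_fun s) (sigma_fun t) <-> joined s t.
Proof.
case: s t => [|b s] [|c t] //=; rewrite ?joined_nil //.
  by rewrite joined_sym (joined_sym (b :: s)) !joined_nil.
by rewrite !joined_cons; split=> -[]; [move/negb_inj|] => ->.
Qed.

Definition sigmaW : W := @MkW sigma_fun sigma_bij erefl sigma_edge.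

Definition is_subgroup (H : set W) : Prop :=
  [/\ H 1, forall x y, H x -> H y -> H (x * y) & forall x, H x -> H x^-1].

Definition generated (S : set W) : set W := smallest is_subgroup S.

Definition top_generated (S : set W) : set W := closure (generated S).

Lemma Wsize (x : W) t : size (x t) = size t.
Proof.
have key n (y : W) s : size s <= n -> size (y s) = size s.
  elim: n => [|n IH] in y s *.
    by case: s => // _; rewrite Wfun_root.
  case/lastP: s => [|s b]; first by rewrite Wfun_root.
  rewrite size_rcons ltnS => sn.
  have: joined (y s) (y (rcons s b)) by apply/Wfun_edge; exists b; left.
  case=> c [e|e]; first by rewrite e size_rcons IH.
  have e1 : (size (y (rcons s b))).+1 = size s by rewrite -(IH y s sn) e size_rcons.
  have le1 : size (y (rcons s b)) <= n by rewrite ltnW // e1.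
  have := IH y^-1 _ le1; have [yK _] := WinvK y; rewrite [y^-1 _]yK size_rcons => e2.
  by move: e1; rewrite -e2 => /eqP; rewrite -[X in _ == X]add0n -addn2 addnC eqn_add2r.
exact: (key _ _ _ (leqnn _)).
Qed.

Lemma agreeM n (x x' y y' : W) :
  agree n x x' -> agree n y y' -> agree n (x * y) (x' * y').
Proof.
move=> xx' yy' t tn; change (x (y t) = x' (y' t)).
by rewrite -yy' // xx' // Wsize.
Qed.

Lemma agreeV n (x x' : W) : agree n x x' -> agree n x^-1 x'^-1.
Proof.
move=> xx' t tn; have [xK Kx] := WinvK x; have [x'K Kx'] := WinvK x'.
apply: (bij_inj (Wfun_bij x')); rewrite [RHS]Kx' -xx' ?Wsize //; exact: Kx.
Qed.

Lemma closureE S (x : W) :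
  closure S x <-> forall n, exists2 y, S y & agree n x y.
Proof.
split=> [h n|h B [n An]].
  have [y [? ?]] := h (agree n x) (ex_intro _ n (fun y h => h)).
  by exists y.
by have [y ? ?] := h n; exists y; split=> //; apply: An.
Qed.

Lemma generated_subgroup S : is_subgroup (generated S).
Proof.
split=> [H [[]] //|x y hx hy H HH|x hx H HH].
- have [[_ M _] _] := HH; apply: M; [exact: hx|exact: hy].
- by have [[_ _ V] _] := HH; apply: V; apply: hx.
Qed.

Lemma closure_subgroup H : is_subgroup H -> is_subgroup (closure H).
Proof.
case=> H1 HM HV; split; first exact: subset_closure.
- move=> x y /closureE hx /closureE hy; apply/closureE => n.
  have [x' ? ?] := hx n; have [y' ? ?] := hy n.
  by exists (x' * y'); [apply: HM|apply: agreeM].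
- move=> x /closureE hx; apply/closureE => n; have [x' ? ?] := hx n.
  by exists x'^-1; [apply: HV|apply: agreeV].
Qed.

(* In a [groupType], [x ^ w] is [w^-1 * (x * w)]. *)
Definition conjugate_under (H : set W) (x y : W) : Prop :=
  exists2 w, H w & y = x ^ w.

Definition Norm (G : set W) : set W :=
  [set w | [set x ^ w | x in G] = G].

(* The maximal profinite abelian factor group of a closed subgroup [G] is the
   quotient of [G] by the closure of its commutator subgroup; [ab_image G x] is
   the image of [x] in it, as a coset. *)
Definition derived (G : set W) : set W :=
  top_generated [set [~ x, y] | x in G & y in G].

(* Maximality of the quotient of a closed [G] by [derived G]. *)
Lemma derived_smallest G : is_subgroup G ->
  smallest
    (fun H => [/\ is_subgroup H, closed H
              & forall x w, G w -> H x -> H (x ^ w)])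
    [set [~ x, y] | x in G & y in G] = derived G.
Proof.
case=> G1 GM GV; apply/seteqP; split.
  apply: (@smallest_sub _ _ _ (derived G)); last first.
    apply: subset_trans (@subset_closure _ _); exact: sub_gen_smallest.
  split; [exact: closure_subgroup (generated_subgroup _)|exact: closed_closure|].
  move=> x w Gw /closureE hx; apply/closureE => n; have [y hy xy] := hx n.
  exists (y ^ w); last by do 2?apply: agreeM => //; apply: agreeV.
  move=> H [HH SH].
  have : (fun z => H (z ^ w) ) y.
    apply: (hy (fun z => H (z ^ w))); split.
      case: HH => H1 HM HV; split; rewrite ?conj1g //.
        by move=> u v Hu Hv; rewrite conjMg; apply: HM.
      by move=> u Hu; rewrite conjVg; apply: HV.
    move=> _ [u Gu [v Gv <-]]; apply: SH.
    have GJ g : G g -> G (g ^ w) by move=> Gg; exact: GM (GV _ Gw) (GM _ _ Gg Gw).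
    rewrite conjRg; exists (u ^ w); first exact: GJ.
    by exists (v ^ w) => //; exact: GJ.
  by [].
move=> x dx H [[HH Hc _] SH]; apply: Hc; apply: closure_subset dx.
exact: smallest_sub.
Qed.

Definition ab_image (G : set W) (x : W) : set W :=
  [set x * d | d in derived G].

(* The generators, realised simultaneously: [gen_fun w i] is the image of [w]
   under the [i]-th one. *)
Section GeneratorRecursion.

Variable r : nat.

Fixpoint gen_fun (w : word) (i : nat) : word := match w with
 | [::] => [::]
 | b :: t => if i == 1%N then (if b then false :: gen_fun t r else true :: t)
             else b :: (if b then t else gen_fun t i.-1) end.

Fixpoint gen_finv (w : word) (i : nat) : word := match w with
 | [::] => [::]
 | b :: t => if i == 1%N then (if b then false :: t else true :: gen_finv t r)
             else b :: (if b then t else gen_finv t i.-1) end.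

Lemma gen_funK i : cancel (gen_fun^~ i) (gen_finv^~ i).
Proof. by move=> w; elim: w i => //= b t IH i; case: ifP => hi; case: b;
  rewrite /= ?hi //= IH. Qed.

Lemma gen_finvK i : cancel (gen_finv^~ i) (gen_fun^~ i).
Proof. by move=> w; elim: w i => //= b t IH i; case: ifP => hi; case: b;
  rewrite /= ?hi //= IH. Qed.

Lemma gen_fun_size i t : size (gen_fun t i) = size t.
Proof. by elim: t i => //= b t IH i; case: ifP => hi; case: b; rewrite /= ?IH. Qed.

Lemma gen_fun_edge i s t : joined (gen_fun s i) (gen_fun t i) <-> joined s t.
Proof.
elim: s t i => [|b s IH] [|c t] i; first by split.
- by rewrite !joined_nil -(gen_fun_size i (c :: t)).
- by rewrite joined_sym (joined_sym (b :: s)) !joined_nil -(gen_fun_size i (b :: s)).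
by rewrite /=; case: ifP => _; case: b; case: c; rewrite !joined_cons ?IH;
  split=> -[].
Qed.

Definition gen_aut i : W :=
  @MkW (gen_fun^~ i) (Bijective (gen_funK i) (gen_finvK i)) erefl
    (gen_fun_edge i).

Lemma recursion_exists : gen_aut 1 = pairW (gen_aut r) 1 * sigmaW /\
  forall i, 2 <= i -> gen_aut i = pairW (gen_aut i.-1) 1.
Proof. by split=> [|[|[|i]] // _]; apply: W_ext => -[|[] t]. Qed.

Lemma recursion_unique (a a' : nat -> W) : 1 <= r ->
  a 1%N = pairW (a r) 1 * sigmaW ->
  (forall i, 2 <= i <= r -> a i = pairW (a i.-1) 1) ->
  a' 1%N = pairW (a' r) 1 * sigmaW ->
  (forall i, 2 <= i <= r -> a' i = pairW (a' i.-1) 1) ->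
  forall i, 1 <= i <= r -> a i = a' i.
Proof.
move=> r1 a1 ai a'1 a'i i ir; apply: W_ext => t.
elim: t => [|b t IH] in i ir *; first by rewrite !Wfun_root.
have [i1|i2] := leqP i 1.
  have -> : i = 1%N by case: i i1 ir => [|[]].
  by rewrite a1 a'1; case: b => //; congr cons; apply: IH; rewrite r1 leqnn.
have /andP[_ ler] := ir; rewrite ai ?i2 // a'i ?i2 //.
case: b => //; congr cons; apply: IH.
by case: i i2 ler {ir} => [|[|i]] // _ /ltnW.
Qed.

End GeneratorRecursion.

Definition standard_odometer (a : W) : Prop := a = pairW a 1 * sigmaW.

Definition odometer (x : W) : Prop :=
  exists2 a, standard_odometer a & conjugate_under setT a x.

(* Main.v *)
Require Import Defs.
From mathcomp Require Import all_boot.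
From mathcomp Require Import all_classical topology.

(** Let [Gam] be the abstract group generated by the [a i], and [Hsub j] the
    normal closure in [Gam] of the [a i] with [i <> j].  A pair [(p, q)] of
    elements of [Gam] lies in [Gam] as soon as [p] and [q] agree modulo
    [Hsub r].  An odometer [x = (u, v) sigma] has [x ^ 2 = (u v, v u)] with
    [u v] again an odometer, so a conjugator of [x] into [y] is obtained
    recursively from one for [u v] and [u' v'].  If [x] and [y] have the same
    image in the abelianization, then so do [u v] and [u' v'], while [u] and [u']
    agree modulo [Hsub r]: the recursive conjugator then stays in [Gam] at every
    finite level, which is (b).  In general, modulo [Hsub r] the square of [u]
    is [a r * (u v)]; this relation, together with the fact that the cyclic group
    of [a r] meets [Hsub r] trivially at each finite level, shows that the same
    conjugator maps each [a i] to a [Gam]-conjugate of an element of the closed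
    subgroup generated by [a i], so it normalizes the closure of [Gam]: (a). *)

Set Implicit Arguments.
Unset Strict Implicit.
Unset Printing Implicit Defensive.

Local Open Scope classical_set_scope.
Local Open Scope group_scope.

(** * Agreement to finite level and limits of coherent sequences *)

Section Agreement.

Implicit Types (n : nat) (x y z w : W).

Lemma mulWE x y t : (x * y) t = x (y t).
Proof. by []. Qed.

Lemma agree_refl n x : agree n x x.
Proof. by []. Qed.

Lemma agree_sym n x y : agree n x y -> agree n y x.
Proof. by move=> xy t tn; rewrite xy. Qed.

Lemma agree_trans n x y z : agree n x y -> agree n y z -> agree n x z.
Proof. by move=> xy yz t tn; rewrite xy ?yz. Qed.

Lemma agree_le m n x y : m <= n -> agree n x y -> agree m x y.
Proof. by move=> mn xy t tm; apply: xy; apply: leq_trans mn. Qed.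

Lemma agree0 x y : agree 0 x y.
Proof. by case=> // _; rewrite !Wfun_root. Qed.

Lemma agree_eq x y : (forall n, agree n x y) -> x = y.
Proof. by move=> xy; apply: W_ext => t; apply: (xy (size t)). Qed.

Lemma agreeJ n x x' y y' :
  agree n x x' -> agree n y y' -> agree n (x ^ y) (x' ^ y').
Proof.
by move=> xx yy; rewrite !conjgE; do 2?apply: agreeM => //; apply: agreeV.
Qed.

Lemma agreeR n x x' y y' :
  agree n x x' -> agree n y y' -> agree n [~ x, y] [~ x', y'].
Proof.
by move=> xx yy; rewrite !commgEl; apply: agreeM; [apply: agreeV|apply: agreeJ].
Qed.

(** Completeness of [W]. Automorphisms preserve length, so the limit and its inverse can both be
    read off at the index [size t]. *)
Lemma agree_limit (p : nat -> W) : (forall n, agree n (p n) (p n.+1)) ->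
  exists w, forall n, agree n (p n) w.
Proof.
move=> pS.
have pD n k : agree n (p n) (p (k + n)%N).
  elim: k => [|k IH]; first exact: agree_refl.
  by apply: agree_trans IH _; apply: agree_le (pS _); rewrite leq_addl.
have pE n t : size t <= n -> p n t = p (size t) t.
  by move=> tn; rewrite -(subnK tn) -(pD (size t)).
pose f t := p (size t) t.
have fK : cancel f (fun t => Winv (p (size t)) t).
  by move=> t; rewrite /f Wsize; case: (WinvK (p (size t))) => ->.
have Kf : cancel (fun t => Winv (p (size t)) t) f.
  by move=> t; rewrite /f Wsize; case: (WinvK (p (size t))) => _ ->.
have f_edge s t : joined (f s) (f t) <-> joined s t.
  (* An edge involves two lengths; at the larger index a single automorphism handles both ends. *)
  rewrite /f -(pE (maxn (size s) (size t)) s) ?leq_maxl //.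
  by rewrite -(pE (maxn (size s) (size t)) t) ?leq_maxr //; apply: Wfun_edge.
exists (MkW (Bijective fK Kf) (Wfun_root _) f_edge) => n t tn.
by rewrite pE.
Qed.

End Agreement.

(** * Wreath coordinates: sections, the swap bit, and the odometer test *)

Section Wreath.

Implicit Types (u v w x y : W) (b e : bool).

Definition wr u v e : W := pairW u v * (if e then sigmaW else 1).

Definition swap w : bool := head false (w [:: false]).

Lemma W_rcons w t b : exists c, w (rcons t b) = rcons (w t) c.
Proof.
have : joined (w t) (w (rcons t b)) by apply/Wfun_edge; exists b; left.
case=> c [|] e; exists c => //; move/(congr1 size): e.
by rewrite size_rcons !Wsize size_rcons -addn2 => /eqP;
  rewrite -[X in X == _]addn0 eqn_add2l.
Qed.

(** Appending a letter to a word only appends a letter to its image, so induction from the end of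
    the word shows that the first letter of the image depends on [b] alone. *)
Lemma W_cons w b t : exists s, w (b :: t) = (b (+) swap w) :: s.
Proof.
have w0 : w [:: false] = [:: swap w].
  by rewrite /swap; have := Wsize w [:: false]; case: (w _) => [|? []].
have w1 : w [:: true] = [:: ~~ swap w].
  have : w [:: true] != w [:: false].
    by apply/eqP => /(bij_inj (Wfun_bij w)).
  rewrite w0; have := Wsize w [:: true]; case: (w _) => [|c []] //= _.
  by case: c (swap w) => -[].
elim/last_ind: t => [|t c [s IH]].
  by exists [::]; case: b.
have [d] := W_rcons w (b :: t) c.
by rewrite -rcons_cons IH => ->; exists (rcons s d).
Qed.

Lemma sec_ex w b : exists u, forall t, w (b :: t) = (b (+) swap w) :: u t.
Proof.
pose c := b (+) swap w.
pose f t := behead (w (b :: t)).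
have fE t : w (b :: t) = c :: f t by rewrite /f; have [s ->] := W_cons w b t.
pose g t := behead (Winv w (c :: t)).
have [wK Kw] := WinvK w.
have gE t : Winv w (c :: t) = b :: g t.
  rewrite /g; have := Kw (c :: t).
  case: (Winv w (c :: t)) => [|d s]; first by rewrite Wfun_root.
  by have [s' ->] := W_cons w d s; case=> /addIb ->.
have fK : cancel f g by move=> t; rewrite /g -fE wK.
have gK : cancel g f by move=> t; rewrite /f -gE Kw.
have f0 : f [::] = [::].
  by apply: size0nil; have := Wsize w [:: b]; rewrite fE => -[].
have f_edge s t : joined (f s) (f t) <-> joined s t.
  have := Wfun_edge w (b :: s) (b :: t); rewrite !fE !joined_cons.
  by case=> h1 h2; split=> h; [apply: (proj2 (h1 _))|apply: (proj2 (h2 _))].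
by exists (MkW (Bijective fK gK) f0 f_edge) => t; apply: fE.
Qed.

Definition sec w b : W := projT1 (cid (sec_ex w b)).

Lemma secE w b t : w (b :: t) = (b (+) swap w) :: sec w b t.
Proof. exact: (projT2 (cid (sec_ex w b))). Qed.

(* Indexed by target letter: [w = wr (lsec w) (rsec w) (swap w)]. *)
Definition lsec w : W := sec w (swap w).
Definition rsec w : W := sec w (~~ swap w).

Lemma wrE u v e b t : wr u v e (b :: t) =
  (b (+) e) :: (if b (+) e then v else u) t.
Proof. by rewrite /wr mulWE; case: e; case: b. Qed.

Lemma wr_sec w : w = wr (lsec w) (rsec w) (swap w).
Proof.
apply: W_ext => -[|b t]; first by rewrite !Wfun_root.
by rewrite wrE secE /lsec /rsec; case: (swap w); case: b.
Qed.

Lemma swap_wr u v e : swap (wr u v e) = e.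
Proof. by rewrite /swap wrE; case: e. Qed.

Lemma lsec_wr u v e : lsec (wr u v e) = u.
Proof.
apply: W_ext => t; have := secE (wr u v e) e t.
by rewrite wrE swap_wr addbb => -[]; rewrite /lsec swap_wr.
Qed.

Lemma rsec_wr u v e : rsec (wr u v e) = v.
Proof.
apply: W_ext => t; have := secE (wr u v e) (~~ e) t.
by rewrite wrE swap_wr addNb addbb => -[]; rewrite /rsec swap_wr.
Qed.

Definition wrS := (lsec_wr, rsec_wr, swap_wr).

Lemma wrM u v e u' v' e' : wr u v e * wr u' v' e' =
  wr (u * (if e then v' else u')) (v * (if e then u' else v')) (e (+) e').
Proof.
apply: W_ext => -[|b t]; first by rewrite !Wfun_root.
by rewrite mulWE !wrE; case: b; case: e; case: e'.
Qed.

Lemma wr1 : wr 1 1 false = 1.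
Proof. by apply: W_ext => -[|[] t]. Qed.

Lemma wrV u v e : (wr u v e)^-1 =
  wr (if e then v else u)^-1 (if e then u else v)^-1 e.
Proof. by apply: mulg1_eq; rewrite wrM -wr1; case: e; rewrite !mulgV. Qed.

Lemma lsecM x y : lsec (x * y) = lsec x * (if swap x then rsec y else lsec y).
Proof. by rewrite {1}(wr_sec x) {1}(wr_sec y) wrM lsec_wr. Qed.

Lemma rsecM x y : rsec (x * y) = rsec x * (if swap x then lsec y else rsec y).
Proof. by rewrite {1}(wr_sec x) {1}(wr_sec y) wrM rsec_wr. Qed.

Lemma swapM x y : swap (x * y) = swap x (+) swap y.
Proof. by rewrite {1}(wr_sec x) {1}(wr_sec y) wrM swap_wr. Qed.

Lemma lsecV x : lsec x^-1 = (if swap x then rsec x else lsec x)^-1.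
Proof. by rewrite {1}(wr_sec x) wrV lsec_wr. Qed.

Lemma rsecV x : rsec x^-1 = (if swap x then lsec x else rsec x)^-1.
Proof. by rewrite {1}(wr_sec x) wrV rsec_wr. Qed.

Lemma swapV x : swap x^-1 = swap x.
Proof. by rewrite {1}(wr_sec x) wrV swap_wr. Qed.

Lemma sec1 : (lsec 1 = 1) * (rsec 1 = 1) * (swap 1 = false).
Proof. by split; [split|]; rewrite -{1}wr1 wrS. Qed.

Definition secM := (lsecM, rsecM, swapM).
Definition secV := (lsecV, rsecV, swapV).

Lemma agree_wr n u v e u' v' :
  agree n u u' -> agree n v v' -> agree n.+1 (wr u v e) (wr u' v' e).
Proof.
move=> uu vv [|b t] tn; first by rewrite !Wfun_root.
by rewrite !wrE; case: (b (+) e); congr cons; [apply: vv|apply: uu].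
Qed.

Lemma agree_wrP n u v e u' v' e' :
  agree n.+1 (wr u v e) (wr u' v' e') ->
  [/\ agree n u u', agree n v v' & e = e'].
Proof.
move=> h; have ee : e = e'.
  by have := h [:: false] isT; rewrite !wrE => -[].
split=> // t tn.
  by have := h (e :: t) tn; rewrite !wrE -ee addbb => -[].
by have := h (~~ e :: t) tn; rewrite !wrE -ee addNb addbb => -[].
Qed.

Lemma agree_sec n x y : agree n.+1 x y ->
  [/\ agree n (lsec x) (lsec y), agree n (rsec x) (rsec y) & swap x = swap y].
Proof. by rewrite {1}(wr_sec x) {1}(wr_sec y) => /agree_wrP. Qed.

Lemma wr0J u v p q : wr u v false ^ wr p q false = wr (u ^ p) (v ^ q) false.
Proof. by rewrite conjgE wrV !wrM. Qed.

Lemma wr1J u v p q : wr u v true ^ wr p q false =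
  wr (p^-1 * (u * q)) (q^-1 * (v * p)) true.
Proof. by rewrite conjgE wrV !wrM. Qed.

(* The common diagonal value, up to conjugation, of [w ^ 2] when [w] swaps. *)
Definition nu w : W := lsec w * rsec w.

Lemma agree_nu n x y : agree n.+1 x y -> agree n (nu x) (nu y).
Proof. by case/agree_sec=> *; apply: agreeM. Qed.

(** Says that [w] permutes the words of length [n] in a single cycle, a property visible at level
    [n]. *)
Fixpoint odometer_upto n w : Prop :=
  if n is m.+1 then swap w /\ odometer_upto m (nu w) else True.

Lemma odometer_upto_agree n x y : agree n x y ->
  odometer_upto n x -> odometer_upto n y.
Proof.
elim: n x y => //= n IH x y xy [sx ox]; have [_ _ <-] := agree_sec xy.
by split=> //; apply: IH ox; apply: agree_nu.
Qed.

Lemma odometer_uptoP n x : odometer x -> odometer_upto n x.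
Proof.
elim: n x => //= n IH x [a sa [w _ ->]].
have aE : a = wr a 1 true by exact: sa.
rewrite (wr_sec w) aE conjgE wrV !wrM /nu !wrS; split; first by case: swap.
(* For [x = a ^ w] the element [nu x] is [a] conjugated by one of the two sections of [w], hence
   again an odometer. *)
apply: IH; exists a => //; case: (swap w).
  exists (rsec w) => //; rewrite mulgA !mul1g -!mulgA conjgE.
  by rewrite mulVKg.
by exists (lsec w) => //; rewrite mul1g -!mulgA mulVKg conjgE.
Qed.

End Wreath.

(** * Subgroups, normal closures and commutators of generated subgroups *)

Section Subgroups.

Implicit Types (G K S X : set W) (x y z g w : W).

Lemma subgroup1 G : is_subgroup G -> G 1.
Proof. by case. Qed.

Lemma subgroupM G x y : is_subgroup G -> G x -> G y -> G (x * y).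
Proof. by case=> _ + _; apply. Qed.

Lemma subgroupV G x : is_subgroup G -> G x -> G x^-1.
Proof. by case=> _ _; apply. Qed.

Lemma subgroupJ G x y : is_subgroup G -> G x -> G y -> G (x ^ y).
Proof.
by move=> sG Gx Gy; rewrite conjgE; do 2?apply: subgroupM => //;
  apply: subgroupV.
Qed.

Lemma sub_generated S : S `<=` generated S.
Proof. exact: sub_gen_smallest. Qed.

Lemma generated_sub S G : is_subgroup G -> S `<=` G -> generated S `<=` G.
Proof. by move=> sG SG; apply: smallest_sub. Qed.

Lemma subgroup_near n G : is_subgroup G ->
  is_subgroup [set x | exists2 y, G y & agree n x y].
Proof.
move=> sG; split=> [|x y [x' Gx xx] [y' Gy yy]|x [x' Gx xx]] /=.
- by exists 1; [apply: subgroup1|].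
- by exists (x' * y'); [apply: subgroupM|apply: agreeM].
- by exists x'^-1; [apply: subgroupV|apply: agreeV].
Qed.

Lemma subgroup_preJ G w : is_subgroup G -> is_subgroup [set x | G (x ^ w)].
Proof.
move=> sG; split=> [|x y Gx Gy|x Gx] /=.
- by rewrite conj1g; apply: subgroup1.
- by rewrite conjMg; apply: subgroupM.
- by rewrite conjVg; apply: subgroupV.
Qed.

Definition normal_closure G S : set W :=
  generated [set x ^ g | x in S & g in G].

Lemma normal_closureJ G S x g : is_subgroup G -> G g ->
  normal_closure G S x -> normal_closure G S (x ^ g).
Proof.
move=> sG Gg; apply: (generated_sub (G := [set x | normal_closure G S (x ^ g)])).
  exact/subgroup_preJ/generated_subgroup.
move=> _ [s Ss [h Gh <-]] /=; rewrite -conjgM; apply: sub_generated.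
by exists s => //; exists (h * g) => //; apply: subgroupM.
Qed.

Lemma normal_closure_sub G S : is_subgroup G -> S `<=` G ->
  normal_closure G S `<=` G.
Proof.
move=> sG SG; apply: generated_sub => // _ [s Ss [g Gg <-]].
by apply: subgroupJ => //; apply: SG.
Qed.

Lemma sub_normal_closure G S : is_subgroup G -> S `<=` normal_closure G S.
Proof.
move=> sG s Ss; apply: sub_generated; exists s => //.
by exists 1; [apply: subgroup1|rewrite conjg1].
Qed.

(** The identities for [[~ x1 * x2, y]] and [[~ x1^-1, y]] extend the left argument from generators
    to the group; inverting the commutator then does the same for the right argument. *)
Lemma generated_commg S K :
  is_subgroup K -> (forall x g, generated S g -> K x -> K (x ^ g)) ->
  (forall x y, S x -> S y -> K [~ x, y]) ->
  forall x y, generated S x -> generated S y -> K [~ x, y].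
Proof.
move=> sK KJ KS.
have sS := generated_subgroup S.
have commS T : (forall x y, S x -> T y -> K [~ x, y]) ->
    forall x y, generated S x -> T y -> K [~ x, y].
  move=> KT x y Sx Ty.
  apply: (generated_sub (G := [set x | generated S x /\ K [~ x, y]]) _ _ Sx).2.
    split=> [|x1 x2 [S1 K1] [S2 K2]|x1 [S1 K1]] /=.
    - by rewrite comm1g; split; [apply: subgroup1 sS|apply: subgroup1 sK].
    - have -> : [~ x1 * x2, y] = [~ x1, y] ^ x2 * [~ x2, y].
        by rewrite !commgEl !conjgE !invgM -!mulgA !mulVKg.
      by split; [apply: (subgroupM sS)|apply: (subgroupM sK) => //; apply: KJ].
    - have -> : [~ x1^-1, y] = ([~ x1, y] ^ x1^-1)^-1.
        by rewrite -conjVg invgR !commgEl !conjgE invgK -!mulgA mulgV mulg1.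
      by split; [|apply: (subgroupV sK); apply: KJ => //]; apply: (subgroupV sS).
  by move=> x1 S1; split; [apply: sub_generated|apply: KT].
apply: (commS (generated S)) => x y Sx Sy.
rewrite -invgR; apply: (subgroupV sK).
by apply: (commS S) => // ? ?; exact: KS.
Qed.

(** * Congruence calculus in an abelian quotient *)

Definition abelian_quotient G K : Prop :=
  [/\ is_subgroup G, is_subgroup K, K `<=` G
    & forall x y, G x -> G y -> K [~ x, y]].

(** Membership in [G] is carried along so that chains of congruences supply their own side
    conditions. *)
Definition eqmod G K x y : Prop := [/\ G x, G y & K (x^-1 * y)].

Lemma eqmodS G K K' x y : K `<=` K' -> eqmod G K x y -> eqmod G K' x y.
Proof. by move=> KK [Gx Gy Kxy]; split=> //; apply: KK. Qed.

Section EqMod.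

Variables G K : set W.
Hypothesis GK : abelian_quotient G K.

Notation "x ~ y" := (eqmod G K x y) (at level 70).

Let sG : is_subgroup G. Proof. by case: GK. Qed.
Let sK : is_subgroup K. Proof. by case: GK. Qed.
Let KG : K `<=` G. Proof. by case: GK. Qed.
Let KR x y : G x -> G y -> K [~ x, y]. Proof. by case: GK => _ _ _; apply. Qed.

(** The commutator clause makes [K] normal in [G], as [x ^ g = x * [~ x, g]]. *)
Lemma quotientJ x g : G g -> K x -> K (x ^ g).
Proof.
move=> Gg Kx; rewrite -(mulVKg x (x ^ g)); apply: subgroupM => //.
by apply: KR => //; apply: KG.
Qed.

Lemma eqmod_refl x : G x -> x ~ x.
Proof. by move=> Gx; split=> //; rewrite mulVg; apply: subgroup1. Qed.

Lemma eqmod_sym x y : x ~ y -> y ~ x.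
Proof.
by case=> Gx Gy xy; split=> //; have := subgroupV sK xy; rewrite invgM invgK.
Qed.

Lemma eqmod_trans x y z : x ~ y -> y ~ z -> x ~ z.
Proof.
case=> Gx Gy xy [_ Gz yz]; split=> //.
by have := subgroupM sK xy yz; rewrite -mulgA mulVKg.
Qed.

Lemma eqmodM x y x' y' : x ~ x' -> y ~ y' -> x * y ~ x' * y'.
Proof.
case=> Gx Gx' xx [Gy Gy' yy]; split; do ?exact: subgroupM.
have := subgroupM sK (quotientJ Gy xx) yy.
by rewrite conjgE !invgM -!mulgA mulVKg.
Qed.

Lemma eqmodC x y : G x -> G y -> x * y ~ y * x.
Proof.
move=> Gx Gy; split; do ?exact: subgroupM.
by rewrite invgM -!mulgA; apply: KR.
Qed.

Lemma eqmodV x y : x ~ y -> x^-1 ~ y^-1.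
Proof.
case=> Gx Gy xy; split; do ?exact: subgroupV.
have := quotientJ (subgroupV sG Gx) (subgroupV sK xy).
by rewrite conjgE invgM !invgK -!mulgA mulgV mulg1.
Qed.

Lemma eqmodJ x g : G x -> G g -> x ^ g ~ x.
Proof.
move=> Gx Gg; apply: eqmod_sym; split=> //; first exact: subgroupJ.
exact: KR.
Qed.

Lemma eqmod1 x : K x <-> x ~ 1.
Proof.
split=> [Kx|[_ _]].
  by split; [exact: KG|exact: subgroup1|rewrite mulg1; apply: subgroupV].
by rewrite mulg1 => /(subgroupV sK); rewrite invgK.
Qed.

Lemma eqmodACA x y z t : G x -> G y -> G z -> G t ->
  x * y * (z * t) ~ x * z * (y * t).
Proof.
move=> Gx Gy Gz Gt; rewrite -!mulgA; apply: eqmodM; first exact: eqmod_refl.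
by rewrite !mulgA; apply: eqmodM; [exact: eqmodC|exact: eqmod_refl].
Qed.

End EqMod.

End Subgroups.

(** * The recursive conjugator between two odometers *)

Section Conjugators.

Implicit Types x y : W.

(* If [x = (u, v) sigma], [y = (u', v') sigma] and [p] conjugates [u * v] to
   [u' * v'], then [(p, u^-1 * p * u')] conjugates [x] to [y]. *)
Fixpoint conjugator n x y : W :=
  if n is m.+1 then
    let p := conjugator m (nu x) (nu y) in
    wr p ((lsec x)^-1 * (p * lsec y)) false
  else 1.

(** Inverting swaps the roles of [x] and [y]; this yields the reverse inclusion in the
    normalizer. *)
Lemma conjugatorV n x y : (conjugator n x y)^-1 = conjugator n y x.
Proof.
elim: n x y => [|n IH] x y /=; first exact: invg1.
by rewrite wrV IH !invgM IH invgK mulgA.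
Qed.

(** Allows odometers in the closure to be replaced, at each level, by approximants in [Gam]. *)
Lemma agree_conjugator n x x' y y' : agree n x x' -> agree n y y' ->
  agree n (conjugator n x y) (conjugator n x' y').
Proof.
elim: n x x' y y' => [|n IH] x x' y y' xx yy //=.
have pp := IH _ _ _ _ (agree_nu xx) (agree_nu yy).
apply: agree_wr => //; have [xx' _ _] := agree_sec xx.
have [yy' _ _] := agree_sec yy.
by apply: agreeM; [apply: agreeV|apply: agreeM].
Qed.

Lemma agree_conjugatorS n x y :
  agree n (conjugator n x y) (conjugator n.+1 x y).
Proof.
elim: n x y => [|n IH] x y; first exact: agree0.
by apply: agree_wr; [apply: IH|do 2?apply: agreeM => //; apply: IH].
Qed.

Lemma conjugatorP n x y : odometer_upto n x -> odometer_upto n y ->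
  agree n (x ^ conjugator n x y) y.
Proof.
elim: n x y => [|n IH] x y; first by move=> *; exact: agree0.
move=> [sx ox] [sy oy]; have := IH _ _ ox oy; rewrite /=.
set p := conjugator n _ _ => pP.
rewrite [x in x ^ _]wr_sec [X in agree _ _ X]wr_sec sx sy wr1J.
rewrite !mulgA mulgK mulVg mul1g; apply: agree_wr => //.
rewrite !invgM invgK -!mulgA.
(* The left section came out exactly. The right one is [(lsec y)^-1 * nu x ^ p], the only place
   where the induction hypothesis enters. *)
have -> : rsec y = (lsec y)^-1 * nu y by rewrite mulKg.
by apply: agreeM => //; move: pP; rewrite conjgE /nu -!mulgA.
Qed.

End Conjugators.

(** * The abstract group [Gam] and its cyclic quotients by [Hsub j] *)

Section Generators.

Variables (r : nat) (a : nat -> W).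

Definition Gam : set W :=
  generated [set a i | i in [set i : nat | (1 <= i <= r)%N]].

Definition Hsub (j : nat) : set W :=
  normal_closure Gam [set a i | i in [set i : nat | (1 <= i <= r)%N /\ i <> j]].

Definition Cyc (j : nat) : set W := generated [set a j].

Definition Der : set W := generated [set [~ x, y] | x in Gam & y in Gam].

(* [a (cprev j)] is the nontrivial section of [a j]. *)
Definition cprev (j : nat) : nat := if j == 1%N then r else j.-1.

Hypothesis hr : (1 <= r)%N.
Hypothesis ha1 : a 1%N = pairW (a r) 1 * sigmaW.
Hypothesis hai : forall i : nat, (2 <= i <= r)%N -> a i = pairW (a i.-1) 1.

Lemma cprev_range j : (1 <= j <= r)%N -> (1 <= cprev j <= r)%N.
Proof.
rewrite /cprev; case: eqP => [_ _|]; first by rewrite hr leqnn.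
by case: j => [|[|j]] //= _ /ltnW.
Qed.

Lemma cprev_inj i j : (1 <= i <= r)%N -> (1 <= j <= r)%N -> cprev i = cprev j ->
  i = j.
Proof.
rewrite /cprev; case: i j => [|[|i]] [|[|j]] //= ir jr; last by case=> ->.
- by move=> rj; rewrite rj ltnn in jr.
- by move=> ri; rewrite -ri ltnn in ir.
Qed.

Lemma gen_wr i : (1 <= i <= r)%N -> a i = wr (a (cprev i)) 1 (i == 1%N).
Proof.
move=> ir; rewrite /cprev; case: eqP => [->|]; first exact: ha1.
by case: i ir => [|[|i]] // ir _; rewrite hai // /wr mulg1.
Qed.

Lemma gen1_wr : a 1%N = wr (a r) 1 true.
Proof. exact: ha1. Qed.

Lemma Gam_subgroup : is_subgroup Gam.
Proof. exact: generated_subgroup. Qed.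

Lemma Gam_gen i : (1 <= i <= r)%N -> Gam (a i).
Proof. by move=> ir; apply: sub_generated; exists i. Qed.

Lemma Cyc_gen j : Cyc j (a j).
Proof. exact: sub_generated. Qed.

Lemma Cyc_subgroup j : is_subgroup (Cyc j).
Proof. exact: generated_subgroup. Qed.

Lemma Cyc_sub_Gam j : (1 <= j <= r)%N -> Cyc j `<=` Gam.
Proof.
by move=> jr; apply: generated_sub Gam_subgroup _ => _ ->; apply: Gam_gen.
Qed.

Lemma Hsub_gen i j : (1 <= i <= r)%N -> i <> j -> Hsub j (a i).
Proof.
by move=> ir ij; apply: sub_normal_closure; [exact: Gam_subgroup|exists i].
Qed.

Lemma Cyc_sub_Hsub i j : (1 <= i <= r)%N -> i <> j -> Cyc i `<=` Hsub j.
Proof.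
move=> ir ij; apply: generated_sub; first exact: generated_subgroup.
by move=> _ ->; apply: Hsub_gen.
Qed.

(** The quotient is generated by the class of [a j], hence abelian: a commutator of two generators
    is trivial or involves some [a i] with [i <> j]. *)
Lemma Hsub_quotient j : abelian_quotient Gam (Hsub j).
Proof.
have sH : is_subgroup (Hsub j) by exact: generated_subgroup.
have HJ x g : Gam g -> Hsub j x -> Hsub j (x ^ g).
  by move=> Gg; apply: normal_closureJ => //; exact: Gam_subgroup.
split=> //; first exact: Gam_subgroup.
  apply: normal_closure_sub; first exact: Gam_subgroup.
  by move=> _ [i [ir _] <-]; apply: Gam_gen.
apply: generated_commg => // _ _ [i ir <-] [k kr <-].
have [ij|/eqP ij] := eqVneq i j; last first.
  rewrite commgEl; apply: (subgroupM sH); last apply: HJ; last exact: Hsub_gen.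
    by apply: (subgroupV sH); apply: Hsub_gen.
  exact: Gam_gen.
have [kj|/eqP kj] := eqVneq k j.
  by rewrite ij kj commgg; apply: subgroup1 sH.
rewrite -invgR commgEl; apply: (subgroupV sH); apply: (subgroupM sH).
  by apply: (subgroupV sH); apply: Hsub_gen.
by apply: HJ; [exact: Gam_gen|apply: Hsub_gen].
Qed.

Lemma Hsub_subgroup j : is_subgroup (Hsub j).
Proof. by case: (Hsub_quotient j). Qed.

Lemma Hsub_sub_Gam j : Hsub j `<=` Gam.
Proof. by case: (Hsub_quotient j). Qed.

Lemma Der_quotient : abelian_quotient Gam Der.
Proof.
split; [exact: Gam_subgroup|exact: generated_subgroup| |].
  apply: generated_sub Gam_subgroup _ => _ [x Gx [y Gy <-]].
  rewrite commgEl; apply: (subgroupM Gam_subgroup).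
    exact: (subgroupV Gam_subgroup).
  exact: (subgroupJ Gam_subgroup).
by move=> x y Gx Gy; apply: sub_generated; exists x => //; exists y.
Qed.

Lemma Der_sub_Hsub j : Der `<=` Hsub j.
Proof.
have [_ sH _ HR] := Hsub_quotient j.
by apply: generated_sub => // _ [x Gx [y Gy <-]]; apply: HR.
Qed.

Lemma Gam_factor j x : (1 <= j <= r)%N -> Gam x ->
  exists b h, [/\ Cyc j b, Hsub j h & x = b * h].
Proof.
move=> jr; have HQ := Hsub_quotient j.
have sH := Hsub_subgroup j; have sC := Cyc_subgroup j.
have HJ b h : Cyc j b -> Hsub j h -> Hsub j (h ^ b).
  by move=> Cb Hh; apply: (quotientJ HQ) Hh; apply: (Cyc_sub_Gam jr).
apply: (generated_sub
  (G := [set x | exists b h, [/\ Cyc j b, Hsub j h & x = b * h]])).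
  split=> [|_ _ [b [h [Cb Hh ->]]] [b' [h' [Cb' Hh' ->]]]|_ [b [h [Cb Hh ->]]]].
  - exists 1, 1; rewrite mulg1.
    by split=> //; [exact: subgroup1 sC|exact: subgroup1 sH].
  - exists (b * b'), (h ^ b' * h'); split; first exact: subgroupM sC Cb Cb'.
      by apply: (subgroupM sH) => //; apply: HJ.
    by rewrite -(mulgA b) -(mulgA b) (mulgA h) (conjgC h) -(mulgA b').
  - have CV := subgroupV sC Cb.
    exists b^-1, (h^-1 ^ b^-1); split=> //.
      by apply: HJ CV _; exact: subgroupV sH Hh.
    by rewrite invgM conjgC.
move=> _ [i ir <-]; have [->|/eqP ij] := eqVneq i j.
  exists (a j), 1; rewrite mulg1; split=> //; first exact: Cyc_gen.
  exact: subgroup1 sH.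
exists 1, (a i); rewrite mul1g; split=> //; first exact: subgroup1 sC.
exact: Hsub_gen.
Qed.

(** * Which pairs lie in [Gam], and the sections of its elements *)

(** On generators: the square of [a 1] is [(a r, a r)]; for [i < r], multiply [a i.+1 = (a i, 1)] by
    its conjugate under [(a 1)^-1], which is [(1, a i)]. *)
Lemma wr_diag g : Gam g -> Gam (wr g g false).
Proof.
have sG := Gam_subgroup.
apply: (generated_sub (G := [set g | Gam (wr g g false)])).
  split=> [|x y Gx Gy|x Gx] /=.
  - by rewrite wr1; apply: subgroup1 sG.
  - by have := subgroupM sG Gx Gy; rewrite wrM.
  - by have := subgroupV sG Gx; rewrite wrV.
have a1 : Gam (a 1%N) by apply: Gam_gen; rewrite hr.
move=> _ [i /andP[i1 ir] <-] /=; move: ir; rewrite leq_eqVlt => /predU1P[->|ir].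
  by have := subgroupM sG a1 a1; rewrite gen1_wr wrM mulg1 mul1g.
have aS : Gam (wr (a i) 1 false).
  have := Gam_gen (i := i.+1); rewrite gen_wr /cprev ?ir //.
  by case: i i1 {ir} => // i _; apply.
have := subgroupM sG aS (subgroupJ sG aS (subgroupV sG a1)).
rewrite conjgE invgK gen1_wr wrV !wrM.
by rewrite !(mulg1, mul1g) mulgV invg1 !mulg1.
Qed.

(** For [i < r] the pair [(1, a i)] is a conjugate of [a i.+1]; conjugating it by [(g, g)] gives
    [(1, a i ^ g)]. *)
Lemma wr_right h : Hsub r h -> Gam (wr 1 h false).
Proof.
have sG := Gam_subgroup.
apply: (generated_sub (G := [set h | Gam (wr 1 h false)])).
  split=> [|x y Gx Gy|x Gx] /=.
  - by rewrite wr1; apply: subgroup1 sG.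
  - by have := subgroupM sG Gx Gy; rewrite wrM mulg1.
  - by have := subgroupV sG Gx; rewrite wrV invg1.
have a1 : Gam (a 1%N) by apply: Gam_gen; rewrite hr.
move=> _ [_ [i [/andP[i1 ir] ni] <-] [g Gg <-]] /=.
move: ir; rewrite leq_eqVlt => /predU1P[//|ir].
have aS : Gam (wr (a i) 1 false).
  have := Gam_gen (i := i.+1); rewrite gen_wr /cprev ?ir //.
  by case: i i1 {ni ir} => // i _; apply.
have := subgroupJ sG (subgroupJ sG aS (subgroupV sG a1)) (wr_diag Gg).
rewrite (conjgE _ (a 1%N)^-1) invgK gen1_wr wrV !wrM wr0J.
by rewrite !(mulg1, mul1g) mulgV invg1 mulg1 conj1g.
Qed.

Lemma Gam_wr p q : eqmod Gam (Hsub r) p q -> Gam (wr p q false).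
Proof.
case=> Gp _ /wr_right G1; have := subgroupM Gam_subgroup (wr_diag Gp) G1.
by rewrite wrM mulg1 mulVKg.
Qed.

(** A converse to [Gam_wr]: the two sections agree modulo [Hsub r], up to one factor [a r] when [w]
    swaps, as in [a 1 = (a r, 1) sigma]. *)
Lemma Gam_sec w : Gam w -> Gam (rsec w) /\ eqmod Gam (Hsub r) (lsec w)
  (if swap w then a r * rsec w else rsec w).
Proof.
have sG := Gam_subgroup; have HQ := Hsub_quotient r.
have Gr : Gam (a r) by apply: Gam_gen; rewrite hr leqnn.
pose T := [set w | Gam (rsec w) /\ eqmod Gam (Hsub r) (lsec w)
  (if swap w then a r * rsec w else rsec w)].
apply: (generated_sub (G := T)) => [|_ [i ir <-]]; last first.
  rewrite /T /= gen_wr // !wrS; split; first exact: subgroup1 sG.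
  rewrite mulg1; case: eqP => [->|i1]; first exact: (eqmod_refl HQ (x := a r)).
  (* For [i <> 1] the nontrivial section has index other than [r], since [r] is [cprev 1]. *)
  apply/(eqmod1 HQ); apply: Hsub_gen; first exact: cprev_range.
  by move=> pr; apply: i1; apply: cprev_inj => //; rewrite hr.
split=> [|x y [Gvx ux] [Gvy uy]|x [Gv ux]] /=.
- rewrite /T /= !sec1; split; first exact: subgroup1 sG.
  exact: (eqmod_refl HQ (subgroup1 sG)).
- have [Gux _ _] := ux; have [Guy _ _] := uy.
  rewrite /T /= !secM; split.
    by apply: (subgroupM sG) => //; case: swap.
  case: (swap x) (swap y) ux uy => -[] ux uy /=.
  (* Both swap: [lsec y] lands in the right section, so the factor [a r] occurs once on each side
     and no extra factor is left. *)
  + apply: (eqmod_trans HQ _ (eqmodM HQ (eqmod_refl HQ Gvx) (eqmod_sym HQ uy))).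
    rewrite mulgA; apply: (eqmodM HQ _ (eqmod_refl HQ Gvy)).
    exact: (eqmod_trans HQ ux (eqmodC HQ Gr Gvx)).
  + by rewrite mulgA; apply: (eqmodM HQ ux (eqmod_sym HQ uy)).
  + apply: (eqmod_trans HQ (eqmodM HQ ux uy)).
    rewrite !mulgA; apply: (eqmodM HQ _ (eqmod_refl HQ Gvy)).
    exact: (eqmodC HQ Gvx Gr).
  + exact: (eqmodM HQ ux uy).
- have [Gux _ _] := ux.
  rewrite /T /= !secV; split; first by apply: (subgroupV sG); case: swap.
  case: (swap x) ux => ux; last exact: (eqmodV HQ ux).
  apply: (eqmod_sym HQ).
  apply: (eqmod_trans HQ (eqmodM HQ (eqmod_refl HQ Gr) (eqmodV HQ ux))).
  rewrite invgM; apply: (eqmod_trans HQ (eqmodC HQ Gr _)).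
    by apply: (subgroupM sG); apply: (subgroupV sG).
  by rewrite mulgVK; apply: (eqmod_refl HQ); exact: subgroupV sG Gv.
Qed.

(** * The map [nu] modulo commutators *)

Lemma Gam_nu w : Gam w -> Gam (nu w).
Proof. by case/Gam_sec=> Gv [Gu _ _]; exact: subgroupM Gam_subgroup Gu Gv. Qed.

(** Both sides are products of the same four sections in different orders; so [nu] induces a
    homomorphism from [Gam] to [Gam / Der]. *)
Lemma eqmod_nuM x y : Gam x -> Gam y ->
  eqmod Gam Der (nu (x * y)) (nu x * nu y).
Proof.
move=> /Gam_sec[Gvx [Gux _ _]] /Gam_sec[Gvy [Guy _ _]]; have DQ := Der_quotient.
rewrite /nu !secM; case: swap; last exact: eqmodACA.
apply: (eqmod_trans DQ (eqmodACA DQ Gux Gvy Gvx Guy)).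
apply: (eqmodM DQ _ (eqmodC DQ Gvy Guy)); apply: (eqmod_refl DQ).
exact: subgroupM Gam_subgroup Gux Gvx.
Qed.

Lemma eqmod_nuV x : Gam x -> eqmod Gam Der (nu x^-1) (nu x)^-1.
Proof.
move=> Gx; have sG := Gam_subgroup; have DQ := Der_quotient.
have Gn := Gam_nu Gx; have GV := subgroupV sG Gx.
rewrite -[X in eqmod _ _ X _](mulKg (nu x)) -[X in eqmod _ _ _ X]mulg1.
apply: (eqmodM DQ (eqmod_refl DQ (subgroupV sG Gn))).
apply: (eqmod_trans DQ (eqmod_sym DQ (eqmod_nuM Gx GV))).
by rewrite mulgV /nu !sec1 mulg1; apply: (eqmod_refl DQ); apply: subgroup1 sG.
Qed.

Lemma eqmod_nuJ x g : Gam x -> Gam g -> eqmod Gam Der (nu (x ^ g)) (nu x).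
Proof.
move=> Gx Gg; have sG := Gam_subgroup; have DQ := Der_quotient.
rewrite conjgE; have GV := subgroupV sG Gg; have Gxg := subgroupM sG Gx Gg.
apply: (eqmod_trans DQ (eqmod_nuM GV Gxg)).
apply: (eqmod_trans DQ (eqmodM DQ (eqmod_nuV Gg) (eqmod_nuM Gx Gg))).
by apply: (eqmodJ DQ); apply: Gam_nu.
Qed.

Lemma nu_subgroup K : is_subgroup K -> Der `<=` K -> K `<=` Gam ->
  is_subgroup [set x | Gam x /\ K (nu x)].
Proof.
move=> sK DK KG; have sG := Gam_subgroup.
have KE x y : eqmod Gam Der x y -> K y -> K x.
  case=> _ _ /DK xy Ky; have := subgroupM sK Ky (subgroupV sK xy).
  by rewrite invgM invgK mulVKg.
split=> [|x y [Gx Kx] [Gy Ky]|x [Gx Kx]] /=.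
- split; first exact: subgroup1 sG.
  by rewrite /nu !sec1 mulg1; apply: subgroup1 sK.
- split; first exact: subgroupM sG Gx Gy.
  by apply: KE (eqmod_nuM Gx Gy) _; apply: subgroupM sK Kx Ky.
- split; first exact: subgroupV sG Gx.
  by apply: KE (eqmod_nuV Gx) _; apply: subgroupV sK Kx.
Qed.

(** Since [nu (a i) = a (cprev i)], [nu] shifts the indices of generators, and [cprev] is
    injective. *)
Lemma Hsub_nu j h : (1 <= j <= r)%N -> Hsub j h -> Hsub (cprev j) (nu h).
Proof.
move=> jr Hh.
have sT := nu_subgroup (Hsub_subgroup (cprev j)) (@Der_sub_Hsub _)
  (@Hsub_sub_Gam _).
apply: (generated_sub sT _ Hh).2 => _ [_ [i [ir ij] <-] [g Gg <-]] /=.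
have Gi := Gam_gen ir.
split; first exact: subgroupJ Gam_subgroup Gi Gg.
apply/(eqmod1 (Hsub_quotient _)).
have nuE := eqmodS (@Der_sub_Hsub (cprev j)) (eqmod_nuJ Gi Gg).
apply: (eqmod_trans (Hsub_quotient _) nuE); apply/(eqmod1 (Hsub_quotient _)).
rewrite gen_wr // /nu !wrS mulg1; apply: Hsub_gen; first exact: cprev_range.
by move/(cprev_inj ir jr).
Qed.

Lemma Der_nu d : Der d -> Der (nu d).
Proof.
have DQ := Der_quotient; have [sG sD DG DR] := DQ.
have sT := nu_subgroup sD (@subset_refl _ _) DG.
move=> Dd; apply: (generated_sub sT _ Dd).2 => _ [x Gx [y Gy <-]] /=.
split; first by apply: DG; apply: DR.
rewrite commgEl; apply/(eqmod1 DQ); have GV := subgroupV sG Gx.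
apply: (eqmod_trans DQ (eqmod_nuM GV (subgroupJ sG Gx Gy))).
apply: (eqmod_trans DQ (eqmodM DQ (eqmod_nuV Gx) (eqmod_nuJ Gx Gy))).
by rewrite mulVg; apply: (eqmod_refl DQ); apply: subgroup1 sG.
Qed.

(** * Sections of [Hsub 1] and of powers of generators *)

(** A conjugate of [a i] with [i <> 1] has one trivial section; the other is a conjugate of
    [a (cprev i)] with [cprev i <> r]. *)
Lemma Hsub1_sec h : Hsub 1 h ->
  [/\ swap h = false, Hsub r (lsec h) & Hsub r (rsec h)].
Proof.
have HQ := Hsub_quotient r; have [sG sH _ _] := HQ.
apply: (generated_sub
  (G := [set h | [/\ swap h = false, Hsub r (lsec h) & Hsub r (rsec h)]])).
  split=> [|x y [ex ux vx] [ey uy vy]|x [ex ux vx]] /=.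
  - by rewrite !sec1; split=> //; apply: subgroup1 sH.
  - by rewrite !secM ex ey; split=> //; apply: (subgroupM sH).
  - by rewrite !secV ex; split=> //; apply: (subgroupV sH).
move=> _ [_ [i [ir i1] <-] [g /Gam_sec[Gv [Gu _ _]] <-]] /=.
have Ha : Hsub r (a (cprev i)).
  apply: Hsub_gen; first exact: cprev_range.
  move=> pr; apply: i1; apply: cprev_inj => //; rewrite ?hr //.
have -> : a i = wr (a (cprev i)) 1 false
  by rewrite gen_wr //; move/eqP/negPf: i1 => ->.
rewrite conjgE !(wrS, secM, secV); case: (swap g) => /=.
- by rewrite mul1g mulVg -conjgE; split=> //;
  [exact: subgroup1 sH|apply: (quotientJ HQ)].
- by rewrite mul1g mulVg -conjgE; split=> //;
  [apply: (quotientJ HQ)|exact: subgroup1 sH].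
Qed.

Lemma Cyc1_sec b : Cyc 1 b -> Cyc r (lsec b) /\ Cyc r (rsec b).
Proof.
have sC := Cyc_subgroup r.
apply: (generated_sub (G := [set b | Cyc r (lsec b) /\ Cyc r (rsec b)])).
  split=> [|x y [ux vx] [uy vy]|x [ux vx]] /=.
  - by rewrite !sec1; split; apply: subgroup1 sC.
  - by rewrite !secM; split; apply: (subgroupM sC) => //; case: swap.
  - by rewrite !secV; split; apply: (subgroupV sC) => //; case: swap.
move=> _ -> /=; rewrite gen1_wr !wrS.
by split; [exact: Cyc_gen|exact: subgroup1 sC].
Qed.

Lemma Cyc_sec j b : (1 <= j <= r)%N -> j <> 1%N -> Cyc j b ->
  exists2 c, Cyc (cprev j) c & b = wr c 1 false.
Proof.
move=> jr /eqP/negPf j1; have sC := Cyc_subgroup (cprev j).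
apply: (generated_sub
  (G := [set b | exists2 c, Cyc (cprev j) c & b = wr c 1 false])).
  split=> [|_ _ [c Cc ->] [d Cd ->]|_ [c Cc ->]] /=.
  - by exists 1; [exact: subgroup1 sC|rewrite wr1].
  - by exists (c * d); [exact: subgroupM sC Cc Cd|rewrite wrM mulg1].
  - by exists c^-1; [exact: subgroupV sC Cc|rewrite wrV invg1].
move=> _ ->; exists (a (cprev j)); first exact: Cyc_gen.
by rewrite gen_wr // j1.
Qed.

Lemma Cyc_wr j c : (1 <= j <= r)%N -> j <> 1%N -> Cyc (cprev j) c ->
  Cyc j (wr c 1 false).
Proof.
move=> jr /eqP/negPf j1; have sC := Cyc_subgroup j.
apply: (generated_sub (G := [set c | Cyc j (wr c 1 false)])).
  split=> [|x y Cx Cy|x Cx] /=.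
  - by rewrite wr1; exact: subgroup1 sC.
  - by have := subgroupM sC Cx Cy; rewrite wrM mulg1.
  - by have := subgroupV sC Cx; rewrite wrV invg1.
by move=> _ -> /=; have := @Cyc_gen j; rewrite (gen_wr jr) j1.
Qed.

Lemma Cyc1_wr b : Cyc r b -> Cyc 1 (wr b b false).
Proof.
have sC := Cyc_subgroup 1.
apply: (generated_sub (G := [set b | Cyc 1 (wr b b false)])).
  split=> [|x y Cx Cy|x Cx] /=.
  - by rewrite wr1; exact: subgroup1 sC.
  - by have := subgroupM sC Cx Cy; rewrite wrM.
  - by have := subgroupV sC Cx; rewrite wrV.
move=> _ -> /=; have C1 := @Cyc_gen 1; have := subgroupM sC C1 C1.
by rewrite (gen1_wr) wrM mulg1 mul1g.
Qed.

(** [Cyc j] and [Hsub j] meet trivially at every finite level. Induction on the level: for [j = 1]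
    pass to both sections, otherwise apply [nu]. *)
Lemma Cyc_Hsub_agree n j b h : (1 <= j <= r)%N -> Cyc j b -> Hsub j h ->
  agree n b h -> agree n b 1.
Proof.
elim: n j b h => [|n IH] j b h jr Cb Hh bh; first exact: agree0.
have [j1|/eqP j1] := eqVneq j 1%N.
  rewrite j1 in Cb Hh; have [Cu Cv] := Cyc1_sec Cb.
  have [ub vb sb] := agree_sec bh; have [sh Hu Hv] := Hsub1_sec Hh.
  have rr : (1 <= r <= r)%N by rewrite hr leqnn.
  rewrite (wr_sec b) sb sh -wr1; apply: agree_wr.
    exact: IH Cu Hu ub.
  exact: IH Cv Hv vb.
have [c Cc bE] := Cyc_sec jr j1 Cb.
rewrite bE -[X in agree _ _ X]wr1; apply: agree_wr => //.
(* The left section of [h] alone need not lie in [Hsub (cprev j)], but [nu h] does, and [nu b = c]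
   because the right section of [b] is trivial. *)
apply: (IH _ _ _ (cprev_range jr) Cc (Hsub_nu jr Hh)).
by have := agree_nu bh; rewrite bE {1}/nu !wrS mulg1.
Qed.

(** * Conjugators at finite level: membership in [Gam], and action on generators *)

(** The congruence modulo [Der] passes to [nu x] and [nu y], which puts [p] in [Gam]; it also makes
    [lsec x] and [lsec y] agree modulo [Hsub r], so that [Gam_wr] applies. *)
Lemma conjugator_Gam n x y : odometer_upto n x -> odometer_upto n y ->
  eqmod Gam Der x y -> Gam (conjugator n x y).
Proof.
have sG := Gam_subgroup; have DQ := Der_quotient.
have HQ := Hsub_quotient r.
elim: n x y => [|n IH] x y /=; first by move=> *; exact: subgroup1 sG.
move=> [sx ox] [sy oy] [Gx Gy Dxy].
have yE : y = x * (x^-1 * y) by rewrite mulVKg.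
have Gd : Gam (x^-1 * y) by case: DQ => _ _ DG _; apply: DG.
have Gp : Gam (conjugator n (nu x) (nu y)).
  apply: IH => //; rewrite yE; apply: (eqmod_sym DQ).
  apply: (eqmod_trans DQ (eqmod_nuM Gx Gd)).
  rewrite -[X in eqmod _ _ _ X]mulg1; apply: (eqmodM DQ).
    by apply: (eqmod_refl DQ); exact: Gam_nu.
  by apply/(eqmod1 DQ); apply: (Der_nu).
apply: (Gam_wr); have [Gv [Gu _ _]] := Gam_sec Gx.
have uu : eqmod Gam (Hsub r) (lsec y) (lsec x).
  have [_ _ Hd] := Hsub1_sec (@Der_sub_Hsub 1 _ Dxy).
  rewrite yE lsecM sx -[X in eqmod _ _ _ X]mulg1.
  by apply: (eqmodM HQ (eqmod_refl HQ Gu)); apply/(eqmod1 HQ).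
apply: (eqmod_sym HQ); apply: (eqmod_trans HQ _ (eqmodJ HQ Gp Gu)).
apply: (eqmodM HQ (eqmod_refl HQ (subgroupV sG Gu))).
exact: (eqmodM HQ (eqmod_refl HQ Gp) uu).
Qed.

(* Stronger than normalizing [Gam] to level [n]: the recursion through [a 1]
   also needs [w] to preserve [Hsub r]. *)
Lemma eqmod_square_shuffle G K s x e k : abelian_quotient G K ->
  G s -> G x -> G e -> G k ->
  eqmod G K (s * x * s * (e * (k * e))) (k * (x * (s * e * (s * e)))).
Proof.
move=> GK Gs Gx Ge Gk; have [sG _ _ _] := GK.
have Gse := subgroupM sG Gs Ge; have Gsx := subgroupM sG Gs Gx.
have Gek := subgroupM sG Ge Gk.
rewrite (mulgA e) (mulgA x) (mulgA k).
apply: (eqmod_trans GK (eqmodACA GK Gsx Gs Gek Ge)).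
apply: (eqmodM GK _ (eqmod_refl GK Gse)).
apply: (eqmod_trans GK _ (eqmodC GK (subgroupM sG Gx Gse) Gk)).
rewrite -(mulgA x) -(mulgA s e) (mulgA x).
by apply: (eqmodM GK _ (eqmod_refl GK Gek)); apply: eqmodC.
Qed.

(** Keeping the index [i] of the cyclic group is what makes every [Hsub j] stable, as [Cyc i] lies
    in [Hsub j] for [i <> j]. *)
Definition power_conj n (w : W) : Prop :=
  forall i, (1 <= i <= r)%N ->
    exists g c, [/\ Gam g, Cyc i c & agree n (a i ^ w) (c ^ g)].

Lemma power_conj_agree n w w' : agree n w w' -> power_conj n w ->
  power_conj n w'.
Proof.
move=> ww pw i ir; have [g [c [Gg Cc aw]]] := pw i ir; exists g, c; split=> //.
by apply: agree_trans aw; apply: agreeJ => //; apply: agree_sym.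
Qed.

Lemma agree_pre_subgroup n w K : is_subgroup K ->
  is_subgroup [set x | exists2 y, K y & agree n (x ^ w) y].
Proof. by move=> sK; apply: (subgroup_preJ w (subgroup_near n sK)). Qed.

Lemma power_conj_Gam n w x : power_conj n w -> Gam x ->
  exists2 y, Gam y & agree n (x ^ w) y.
Proof.
have sG := Gam_subgroup => pw.
apply: (generated_sub (agree_pre_subgroup n w sG)) => _ [i ir <-].
have [g [c [Gg Cc aw]]] := pw i ir; exists (c ^ g) => //.
exact: subgroupJ sG (Cyc_sub_Gam ir Cc) Gg.
Qed.

Lemma power_conj_Hsub n w j h : power_conj n w -> Hsub j h ->
  exists2 h', Hsub j h' & agree n (h ^ w) h'.
Proof.
have HQ := Hsub_quotient j; have [sG sH _ _] := HQ => pw.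
apply: (generated_sub (agree_pre_subgroup n w sH)).
move=> _ [_ [i [ir ij] <-] [g Gg <-]].
have [g1 [c [Gg1 Cc aw]]] := pw i ir.
have [g2 Gg2 gw] := power_conj_Gam pw Gg.
exists ((c ^ g1) ^ g2); last by rewrite conjJg; apply: agreeJ.
by do 2?apply: (quotientJ HQ) => //; apply: Cyc_sub_Hsub Cc.
Qed.

(** For [i <> 1], conjugate by [(g, g)]. For [i = 1], with [q] the right section of the conjugator,
    [a 1] goes at level [n.+1] to [(c ^ g * t^-1, t) sigma], where [c ^ g] approximates [a r ^ p]
    and [t = u'^-1 * e] approximates [u'^-1 * u ^ p]. *)
Lemma power_conj_wr n x y p : Gam x -> Gam y -> swap x -> swap y ->
  power_conj n p -> agree n (nu x ^ p) (nu y) ->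
  power_conj n.+1 (wr p ((lsec x)^-1 * (p * lsec y)) false).
Proof.
move=> Gx Gy sx sy pp xy i ir; set q := (_ * _)%g.
have sG := Gam_subgroup; have HQ := Hsub_quotient r.
have [i1|/eqP i1] := eqVneq i 1%N; last first.
  have [g [c [Gg Cc aw]]] := pp _ (cprev_range ir).
  exists (wr g g false), (wr c 1 false); split.
  - exact: wr_diag.
  - exact: Cyc_wr.
  - rewrite (gen_wr ir) (introF eqP i1) !wr0J !conj1g.
    exact: agree_wr.
have rr : (1 <= r <= r)%N by rewrite hr leqnn.
have Gr : Gam (a r) by exact: Gam_gen.
have [Gvx] := Gam_sec Gx; have [Gvy] := Gam_sec Gy.
rewrite sx sy => uy ux; have [Gux _ _] := ux; have [Guy _ _] := uy.
rewrite i1 {i ir i1}.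
set u := lsec x in q Gux ux *; set u' := lsec y in q Guy uy *.
have [g [c [Gg Cc arp]]] := pp r rr.
have [e Ge ue] := power_conj_Gam pp Gux.
have Gc := Cyc_sub_Gam rr Cc.
(* Modulo [Hsub r] the right section of [w] is [(a r)^-1 * lsec w], so [nu w] is determined by the
   left one. *)
have nuE w : Gam w -> swap w ->
    eqmod Gam (Hsub r) (lsec w * ((a r)^-1 * lsec w)) (nu w).
  move=> Gw sw; have [Gv] := Gam_sec Gw; rewrite sw => ww.
  have [Gu _ _] := ww; apply: (eqmodM HQ (eqmod_refl HQ Gu)).
  have := eqmodM HQ (eqmod_refl HQ (subgroupV sG Gr)) ww.
  by rewrite mulKg.
have [_ _ Hd] := nuE x Gx sx.
have nxE : nu x = u * ((a r)^-1 * u) * ((u * ((a r)^-1 * u))^-1 * nu x).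
  by rewrite mulVKg.
have [h Hh dh] := power_conj_Hsub pp Hd.
move: {Hd} (_ * nu x) nxE dh => d nxE dh.
(* The image under [p] of [nu x = u * ((a r)^-1 * u) * d], factor by factor; hence it approximates
   [nu y]. *)
set z := e * ((c ^ g)^-1 * e) * h.
have zy : agree n z (nu y).
  apply: agree_trans (agree_sym _) xy.
  rewrite nxE !conjMg conjVg.
  by do 3?apply: agreeM => //; apply: agreeV.
have zE : eqmod Gam (Hsub r) (e * (c^-1 * e)) z.
  rewrite -[X in eqmod _ _ X _]mulg1; apply: (eqmodM HQ); last first.
    exact/(eqmod_sym HQ)/(eqmod1 HQ).
  apply: (eqmodM HQ (eqmod_refl HQ Ge)).
  apply: (eqmodM HQ _ (eqmod_refl HQ Ge)).
  by apply: (eqmodV HQ); apply: (eqmod_sym HQ); exact: eqmodJ.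
set t := u'^-1 * e.
have Gt : Gam t by apply: (subgroupM sG) => //; apply: (subgroupV sG).
have [b [k [Cb Hk tE]]] := Gam_factor rr Gt.
have Gb := Cyc_sub_Gam rr Cb.
have tb : eqmod Gam (Hsub r) t b.
  rewrite tE -[X in eqmod _ _ _ X]mulg1; apply: (eqmodM HQ (eqmod_refl HQ Gb)).
  exact/(eqmod1 HQ).
(* The exponent of [c] is forced: comparing [z] with [nu y] modulo [Hsub r] shows that [B] in
   [Cyc r] is congruent to [(nu y)^-1 * z], which is trivial at level [n]; [Cyc_Hsub_agree] then
   makes [B] trivial there. *)
have cE : agree n (a r * (b * b)) c.
  have sC := Cyc_subgroup r.
  pose B := c^-1 * (a r * (b * b)).
  have CB : Cyc r B.
    apply: (subgroupM sC); first exact: subgroupV sC Cc.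
    by apply: (subgroupM sC); [exact: Cyc_gen|apply: (subgroupM sC)].
  have Bz : eqmod Gam (Hsub r) B ((nu y)^-1 * z).
    have GtV := subgroupV sG Gc; have Gt2 := subgroupM sG Gt Gt.
    apply: (eqmod_trans HQ (y := c^-1 * (a r * (t * t)))).
      apply: (eqmodM HQ (eqmod_refl HQ GtV)).
      apply: (eqmodM HQ (eqmod_refl HQ Gr)).
      exact/(eqmod_sym HQ)/(eqmodM HQ tb tb).
    apply: (eqmod_sym HQ).
    apply: (eqmod_trans HQ _
      (eqmod_square_shuffle HQ (subgroupV sG Guy) Gr Ge GtV)).
    apply: (eqmodM HQ _ (eqmod_sym HQ zE)).
    have := eqmodV HQ (eqmod_sym HQ (nuE y Gy sy)).
    by rewrite !invgM invgK.
  have [_ _ HB] := eqmod_sym HQ Bz.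
  have B1 : agree n B 1.
    apply: (Cyc_Hsub_agree rr CB HB).
    rewrite -[X in agree n X _]mul1g -{1}invg1 -(mulVg (nu y)).
    apply: agreeM => //; apply: agreeV; apply: agreeM => //.
    exact: agree_sym.
  by have := agreeM (@agree_refl n c) B1; rewrite mulVKg mulg1.
have Gq : eqmod Gam (Hsub r) g (b * (g * t^-1)).
  apply: (eqmod_sym HQ).
  apply: (eqmod_trans HQ _ (eqmodJ HQ Gg (subgroupV sG Gb))).
  rewrite conjgE invgK; apply: (eqmodM HQ (eqmod_refl HQ Gb)).
  by apply: (eqmodM HQ (eqmod_refl HQ Gg)); exact: eqmodV.
(* The power of [a 1] is [(a r * b, b) sigma]; the right entry of the conjugator is chosen to make
   the right section exactly [t], and the left one becomes [(a r * (b * b)) ^ g * t^-1]. *)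
exists (wr g (b * (g * t^-1)) false), (a 1 * wr b b false); split.
- exact: Gam_wr.
- by apply: (subgroupM (Cyc_subgroup 1)); [exact: Cyc_gen|exact: Cyc1_wr].
- rewrite (gen1_wr) wrM !wr1J !mul1g; apply: agree_wr.
    have -> : p^-1 * (a r * q) = a r ^ p * (u ^ p)^-1 * u'.
      by rewrite !conjgE /q !invgM invgK -!mulgA !mulVKg.
    have -> : g^-1 * (a r * b * (b * (g * t^-1))) = (a r * (b * b)) ^ g * t^-1.
      by rewrite conjgE -!mulgA.
    apply: agree_trans (agreeM (agreeM arp (agreeV ue)) (@agree_refl n u')) _.
    rewrite -mulgA {1}/t invgM invgK; apply: agreeM => //.
    by apply: agreeJ => //; apply: agree_sym.
  have -> : q^-1 * p = u'^-1 * u ^ p.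
    by rewrite conjgE /q !invgM invgK -!mulgA.
  have -> : (b * (g * t^-1))^-1 * (b * g) = t.
    by rewrite 2!invgM invgK -2!mulgA mulKg mulVg mulg1.
  by apply: agreeM.
Qed.

Lemma conjugator_power_conj n x y : Gam x -> Gam y ->
  odometer_upto n x -> odometer_upto n y -> power_conj n (conjugator n x y).
Proof.
elim: n x y => [|n IH] x y Gx Gy.
  move=> _ _ i ir; exists 1, 1; split; last exact: agree0.
    exact: subgroup1 (Gam_subgroup).
  exact: subgroup1 (Cyc_subgroup i).
move=> [sx ox] [sy oy]; apply: power_conj_wr => //; last exact: conjugatorP.
by apply: IH => //; apply: Gam_nu.
Qed.

(** * Passage to the closure and to the limit conjugator *)

Lemma closure_power_conj w x : (forall n, power_conj n w) ->
  closure Gam x -> closure Gam (x ^ w).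
Proof.
move=> pw /Defs.closureE Gx; apply/Defs.closureE => n; have [x' Gx' xx] := Gx n.
have [y Gy xy] := power_conj_Gam (pw n) Gx'; exists y => //.
by apply: agree_trans xy; apply: agreeJ.
Qed.

Lemma conjugator_limit x y : exists w, forall n, agree n (conjugator n x y) w.
Proof. by apply: agree_limit => n; apply: agree_conjugatorS. Qed.

Lemma conjugator_limitP x y w : odometer x -> odometer y ->
  (forall n, agree n (conjugator n x y) w) -> y = x ^ w.
Proof.
move=> ox oy cw; apply: agree_eq => n; apply: agree_sym.
apply: agree_trans (conjugatorP (odometer_uptoP n ox) (odometer_uptoP n oy)).
by apply: agreeJ => //; apply: agree_sym.
Qed.

(** At level [n], replace [x] and [y] by elements of [Gam]; neither the odometer test nor the
    conjugator changes at that level. *)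
Lemma limit_power_conj x y w : closure Gam x -> closure Gam y ->
  odometer x -> odometer y -> (forall n, agree n (conjugator n x y) w) ->
  forall n, power_conj n w.
Proof.
move=> /Defs.closureE Gx /Defs.closureE Gy ox oy cw n.
have [x' Gx' xx] := Gx n; have [y' Gy' yy] := Gy n.
apply: power_conj_agree (cw n) _.
apply: power_conj_agree (agree_sym (agree_conjugator xx yy)) _.
apply: conjugator_power_conj => //.
  exact: odometer_upto_agree xx (odometer_uptoP n ox).
exact: odometer_upto_agree yy (odometer_uptoP n oy).
Qed.

(** Commutators are continuous, so those of the closure are approximated by commutators of [Gam]. *)
Lemma derived_near n d : derived (closure Gam) d ->
  exists2 d', Der d' & agree n d d'.
Proof.
move=> /Defs.closureE/(_ n)[d1 Dd1 dd1].
have sD : is_subgroup (Der) by case: (Der_quotient).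
suff [d2 Dd2 dd2] : exists2 d2, Der d2 & agree n d1 d2.
  by exists d2 => //; apply: agree_trans dd1 dd2.
apply: (generated_sub (subgroup_near n sD) _ Dd1).
move=> _ [x /Defs.closureE/(_ n)[x' Gx xx] [y /Defs.closureE/(_ n)[y' Gy yy] <-]].
exists [~ x', y']; last exact: agreeR.
by apply: sub_generated; exists x' => //; exists y'.
Qed.

End Generators.

(** * Conjugacy of odometers under the normalizer and under the group *)

Theorem theorem2p7p4 (r : nat) (a : nat -> W) (G : set W)
    (hr : (1 <= r)%N)
    (ha1 : a 1%N = pairW (a r) 1 * sigmaW)
    (hai : forall i : nat, (2 <= i <= r)%N -> a i = pairW (a i.-1) 1)
    (hG : G = top_generated [set a i | i in [set i : nat | (1 <= i <= r)%N]]) :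
  (forall x y : W, G x -> G y -> odometer x -> odometer y ->
     conjugate_under (Norm G) x y) /\
  (forall x y : W, G x -> G y -> odometer x -> odometer y ->
     ab_image G x = ab_image G y -> conjugate_under G x y).
Proof.
have {hG}-> : G = closure (Gam r a) by [].
split=> x y Gx Gy ox oy.
  have [w cw] := conjugator_limit x y.
  have pw := limit_power_conj hr ha1 hai Gx Gy ox oy cw.
  (* [w^-1] is the limit of the conjugators from [y] to [x]; it gives surjectivity of conjugation by
     [w] on the closure. *)
  have pV : forall n, power_conj r a n w^-1.
    apply: (limit_power_conj hr ha1 hai Gy Gx oy ox) => n.
    by rewrite -conjugatorV; apply: agreeV.
  exists w; last exact: conjugator_limitP cw.
  apply/seteqP; split=> [_ [z Gz <-]|z Gz]; first exact: closure_power_conj.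
  by exists (z ^ w^-1); [exact: closure_power_conj|rewrite conjgKV].
move=> xy; have [w cw] := conjugator_limit x y.
exists w; last exact: conjugator_limitP cw.
have sD : is_subgroup (derived (closure (Gam r a))).
  exact: closure_subgroup (generated_subgroup _).
have [d Dd yE] : ab_image (closure (Gam r a)) x y.
  by rewrite xy; exists 1; [exact: subgroup1 sD|rewrite mulg1].
apply/Defs.closureE => n.
have [x' Gx' xx] := (Defs.closureE _ _).1 Gx n.
have [d' Dd' dd] := derived_near n Dd.
(* Approximating [y] by [x' * d'] makes the congruence modulo [Der] with [x'] exact, as
   [conjugator_Gam] demands. *)
have yy : agree n y (x' * d') by rewrite -yE; apply: agreeM.
exists (conjugator n x' (x' * d')); last first.
  by apply: agree_trans (agree_sym (cw n)) (agree_conjugator xx yy).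
have [sG _ DG _] := Der_quotient r a.
apply: conjugator_Gam => //.
- exact: odometer_upto_agree xx (odometer_uptoP n ox).
- exact: odometer_upto_agree yy (odometer_uptoP n oy).
by split=> //; [apply: (subgroupM sG) => //; apply: DG|rewrite mulKg].
Qed.
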